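(* Let $(x^k)_{k\in\mathbb{N}}$ be an infinite sequence generated by GInexPM with constant step size $\alpha$ satisfying $0<\alpha<(1-2\bar\gamma)/L$ (as described in the context), and assume $\Omega^*\neq\varnothing$. Let $$\nu:=\frac{1-\bar\gamma_2-\bar\gamma}{\alpha}-\frac L2>0,\qquad \rho:=\frac{\alpha}{1-2\bar\gamma_2}>0,\qquad \eta:=f(x^0)-f^*+\rho\,b_{-1}.$$ Then, for all $N\in\mathbb{N}$, $$\min\{\|x^{k+1}-x^k\|:\ k=0,1,\dots,N\}\le\frac{\sqrt{\eta/\nu}}{\sqrt{N+1}}.$$
   Context: Setting. $C\subset\mathbb{R}^n$ is a nonempty closed convex set, $f:\mathbb{R}^n\to\mathbb{R}$ is continuously differentiable (not assumed convex), $f^*:=\inf_{x\in C}f(x)$, $\Omega^*$ is the set of minimizers of $f$ over $C$, $\langle\cdot,\cdot\rangle$ and $\|\cdot\|$ are the Euclidean inner product and norm, and $\mathbb{N}=\{0,1,2,\dots\}$. The gradient is Lipschitz on $C$ with constant $L>0$: $\|\nabla f(x)-\nabla f(y)\|\le L\|x-y\|$ for all $x,y\in C$. Inexact projection. For each $\gamma=(\gamma_1,\gamma_2,\gamma_3)\in\mathbb{R}^3_+$ (nonnegative entries), $\varphi_\gamma:\mathbb{R}^n\times\mathbb{R}^n\times\mathbb{R}^n\to[0,\infty)$ is a function with $\varphi_\gamma(u,v,w)\le\gamma_1\|v-u\|^2+\gamma_2\|w-v\|^2+\gamma_3\|w-u\|^2$ for all $u,v,w$. For $u\in C$ and $v\in\mathbb{R}^n$,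 $\mathcal{P}_C(\varphi_\gamma,u,v):=\{w\in C:\langle v-w,y-w\rangle\le\varphi_\gamma(u,v,w)\ \forall y\in C\}$. GInexPM with constant step size. Fix a nonincreasing sequence $(b_k)_{k\in\mathbb{N}}$ of nonnegative reals converging to $0$, a real $b_{-1}>b_0$ with $b_{-1}>0$, and reals $a_k$ with $0\le a_k\le b_{k-1}-b_k$ for all $k\in\mathbb{N}$. Fix constants $\bar\gamma_2<1/2$, $\bar\gamma<1/2$ and a step size $\alpha$ with $0<\alpha<(1-2\bar\gamma)/L$. Start from $x^0\in C$. At iteration $k$: if $\nabla f(x^k)=0$ stop; otherwise choose reals $\gamma_1^k,\gamma_2^k,\gamma_3^k\ge 0$ with $\gamma_1^k+\gamma_2^k\le a_k/\|\nabla f(x^k)\|^2$, $\gamma_2^k<\bar\gamma_2$, $\gamma_3^k<\bar\gamma$, set $\gamma^k=(\gamma_1^k,\gamma_2^k,\gamma_3^k)$, $z^k:=x^k-\alpha\nabla f(x^k)$, and let $x^{k+1}$ be any element of $\mathcal{P}_C(\varphi_{\gamma^k},x^k,z^k)$. ''Infinite sequence generated'' means the algorithm never stops. *)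

(* Defs.v *)
(* MathComp / MathComp-Analysis *)
From HB Require Import structures.
From mathcomp Require Import all_boot all_order all_algebra.
From mathcomp Require Import all_classical all_reals all_analysis.

Set Implicit Arguments.
Unset Strict Implicit.
Unset Printing Implicit Defensive.

Import Order.TTheory GRing.Theory Num.Theory.
Import numFieldNormedType.Exports.

Local Open Scope classical_set_scope.
Local Open Scope ring_scope.

Section Euclidean.
Context {R : realType} {n : nat}.
Implicit Types u v : 'rV[R]_n.

Definition dot u v : R := \sum_(i < n) u 0 i * v 0 i.

(* The library norm `|v| on 'rV[R]_n is the sup norm: it induces the same
   topology and the same differentials, but not the same metric estimates. *)
Definition enorm v : R := Num.sqrt (dot v v).

Definition grad (f : 'rV[R]_n -> R) (x : 'rV[R]_n) : 'rV[R]_n :=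
  \row_(i < n) 'D_('e_i) f x.

Lemma diff_grad (f : 'rV[R]_n -> R) (x h : 'rV[R]_n) :
  differentiable f x -> 'd f x h = dot (grad f x) h.
Proof.
move=> df; rewrite {1}(row_sum_delta h) linear_sum /dot.
by apply: eq_bigr => i _; rewrite linearZ /= mxE deriveE // mulrC.
Qed.

Definition continuously_differentiable (f : 'rV[R]_n -> R) : Prop :=
  (forall x, differentiable f x) /\ continuous (grad f).

Definition minimizers (C : set 'rV[R]_n) (f : 'rV[R]_n -> R) : set 'rV[R]_n :=
  [set x | C x /\ forall y, C y -> f x <= f y].

End Euclidean.

Section InexactProjection.
Context {R : realType} {n : nat}.

(* A family phi g1 g2 g3 of error tolerances, constrained only for
   nonnegative parameters. *)
Definition error_tolerance
    (phi : R -> R -> R -> 'rV[R]_n -> 'rV[R]_n -> 'rV[R]_n -> R) : Prop :=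
  forall g1 g2 g3, 0 <= g1 -> 0 <= g2 -> 0 <= g3 ->
  forall u v w,
    0 <= phi g1 g2 g3 u v w /\
    phi g1 g2 g3 u v w <=
      g1 * enorm (v - u) ^+ 2 + g2 * enorm (w - v) ^+ 2
      + g3 * enorm (w - u) ^+ 2.

Definition inexact_proj (C : set 'rV[R]_n)
    (phi : 'rV[R]_n -> 'rV[R]_n -> 'rV[R]_n -> R) (u v : 'rV[R]_n) :
    set 'rV[R]_n :=
  [set w | C w /\ forall y, C y -> dot (v - w) (y - w) <= phi u v w].

End InexactProjection.

Section GInexPM.
Context {R : realType} {n : nat}.

(* shift_prev bm1 b k is b_{k-1}, with bm1 standing for b_{-1}. *)
Definition shift_prev (bm1 : R) (b : nat -> R) (k : nat) : R :=
  if k is k'.+1 then b k' else bm1.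

Definition forcing_sequences (bm1 : R) (b a : nat -> R) : Prop :=
  [/\ nonincreasing_seq b, forall k, 0 <= b k, b @ \oo --> (0 : R),
      b 0%N < bm1 /\ 0 < bm1
    & forall k, 0 <= a k <= shift_prev bm1 b k - b k].

(* x is an infinite run: the stopping test, a vanishing gradient, never
   succeeds. *)
Definition GInexPM_sequence (C : set 'rV[R]_n) (f : 'rV[R]_n -> R)
    (phi : R -> R -> R -> 'rV[R]_n -> 'rV[R]_n -> 'rV[R]_n -> R)
    (a : nat -> R) (gbar2 gbar alpha : R) (x : nat -> 'rV[R]_n) : Prop :=
  C (x 0%N) /\
  forall k : nat,
    grad f (x k) <> 0 /\
    exists g1 g2 g3 : R,
      [/\ [/\ 0 <= g1, 0 <= g2 & 0 <= g3],
          g1 + g2 <= a k / enorm (grad f (x k)) ^+ 2,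
          g2 < gbar2,
          g3 < gbar
        & inexact_proj C (phi g1 g2 g3) (x k)
            (x k - alpha *: grad f (x k)) (x k.+1)].

End GInexPM.

(* Main.v *)
Require Import Defs.
From mathcomp Require Import all_boot all_order all_algebra.
From mathcomp Require Import all_classical all_reals all_analysis.
From mathcomp Require Import ring lra.
Import Order.TTheory GRing.Theory Num.Theory.
Import numFieldNormedType.Exports.
Local Open Scope classical_set_scope.
Local Open Scope ring_scope.

(** Up to errors rho * a_k with bounded sum, each iteration decreases f by a
    multiple of the squared step length. Indeed, testing the inexact projection
    inequality with y = u, the current iterate, bounds <grad f u, w - u> above
    by rho * a_k minus ((1 - gbar2 - gbar) / alpha) * |w - u|^2
    ([inexact_proj_step]): the error tolerance is quadratic, so its part along
    w - u is absorbed by the quadratic term of the projection, and its part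
    along the gradient is what the forcing term a_k controls. Since the gradient
    is L-Lipschitz on C, f lies below its quadratic model with curvature L
    ([descent_lemma]). Adding both,
    [[
      nu * |x_{k+1} - x_k|^2 <= f x_k - f x_{k+1} + rho * a_k.
    ]]
    Summing over k <= N, the values of f telescope and are bounded below by
    fstar, and the a_k sum to at most b_{-1} ([forcing_sum_le]), so the squared
    steps sum to at most eta / nu. The smallest of N + 1 nonnegative numbers is
    at most their root mean square ([bigmin_le_sqrt_mean]). *)

Section Euclidean.
Set Implicit Arguments.
Unset Strict Implicit.
Context {R : realType} {n : nat}.
Implicit Types u v w : 'rV[R]_n.

Lemma dotC u v : dot u v = dot v u.
Proof. by apply: eq_bigr => i _; rewrite mulrC. Qed.

Lemma dotDl u v w : dot (u + v) w = dot u w + dot v w.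
Proof.
by rewrite /dot -big_split; apply: eq_bigr => i _; rewrite mxE mulrDl.
Qed.

Lemma dotZl (c : R) u v : dot (c *: u) v = c * dot u v.
Proof. by rewrite /dot mulr_sumr; apply: eq_bigr => i _; rewrite mxE mulrA. Qed.

Lemma dotNl u v : dot (- u) v = - dot u v.
Proof. by rewrite -scaleN1r dotZl mulN1r. Qed.

Lemma dotDr u v w : dot u (v + w) = dot u v + dot u w.
Proof. by rewrite ![dot u _]dotC dotDl. Qed.

Lemma dotZr (c : R) u v : dot u (c *: v) = c * dot u v.
Proof. by rewrite ![dot u _]dotC dotZl. Qed.

Lemma dotNr u v : dot u (- v) = - dot u v.
Proof. by rewrite ![dot u _]dotC dotNl. Qed.

Definition dotE := (dotDl, dotDr, dotNl, dotNr, dotZl, dotZr).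

Lemma dot_ge0 u : 0 <= dot u u.
Proof. by apply: sumr_ge0 => i _; rewrite -expr2 sqr_ge0. Qed.

Lemma enorm_ge0 u : 0 <= enorm u.
Proof. exact: sqrtr_ge0. Qed.

Lemma enorm_sqr u : enorm u ^+ 2 = dot u u.
Proof. by rewrite sqr_sqrtr ?dot_ge0. Qed.

Lemma enormZ (c : R) u : 0 <= c -> enorm (c *: u) = c * enorm u.
Proof.
move=> c0; rewrite /enorm !dotE mulrA -expr2 sqrtrM ?sqr_ge0//.
by rewrite sqrtr_sqr ger0_norm.
Qed.

Lemma enorm_eq0 u : enorm u = 0 -> u = 0.
Proof.
move=> u0; have := enorm_sqr u; rewrite u0 expr0n /= => /esym uu0.
apply/rowP => i; rewrite mxE; apply/eqP; rewrite -sqrf_eq0 expr2.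
apply/eqP; apply: (psumr_eq0P _ uu0) => // j _.
by rewrite -expr2 sqr_ge0.
Qed.

(** For nonzero vectors this expands 0 <= | |v| u - |u| v |^2 and divides by
    2 |u| |v|. *)
Lemma Cauchy_Schwarz u v : dot u v <= enorm u * enorm v.
Proof.
have [/enorm_eq0 ->|u0] := eqVneq (enorm u) 0.
  by rewrite -(scale0r 0) dotZl mul0r mulr_ge0 ?enorm_ge0.
have [/enorm_eq0 ->|v0] := eqVneq (enorm v) 0.
  by rewrite -(scale0r 0) dotZr mul0r mulr_ge0 ?enorm_ge0.
have uv0 : 0 < enorm u * enorm v by rewrite mulr_gt0 // lt_def enorm_ge0 andbT.
have := dot_ge0 (enorm v *: u - enorm u *: v).
rewrite !dotE -!enorm_sqr (dotC v u) => h.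
rewrite -(ler_pM2l uv0).
lra.
Qed.

(** The difference quotient of s |-> f (u + s v) at t is literally the one
    defining the directional derivative of f at u + t v, so no chain rule is
    involved. *)
Lemma is_derive_along (f : 'rV[R]_n -> R) u v (t : R) :
  differentiable f (u + t *: v) ->
  is_derive t 1 (fun s : R => f (u + s *: v)) (dot (grad f (u + t *: v)) v).
Proof.
move=> df; rewrite -(diff_grad _ df) -deriveE //.
have E :
    (fun h : R => h^-1 *: (((fun s : R => f (u + s *: v)) \o shift t) (h *: 1)
                           - f (u + t *: v))) =
    (fun h : R => h^-1 *: ((f \o shift (u + t *: v)) (h *: v)
                           - f (u + t *: v))).
  apply/funext => h /=; congr (_ *: (f _ - _)).
  by rewrite scaler1 scalerDl addrCA.
split; first by rewrite /derivable E; exact: diff_derivable.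
by rewrite /derive E.
Qed.

Lemma convex_segment (C : set 'rV[R]_n) u w (t : R) :
  convex_set C -> C u -> C w -> 0 <= t <= 1 -> C (u + t *: (w - u)).
Proof.
move=> cC Cu Cw /andP[t0 t1].
have := cC w u (Itv01 t0 t1); rewrite !inE => /(_ Cw Cu).
congr (C _); rewrite [X in X = _](_ : _ = t *: w + (1 - t) *: u) //.
by rewrite scalerBr scalerBl scale1r addrCA.
Qed.

(** The mean value theorem is applied to the gap psi between f and its quadratic
    model along the segment from u to w: by Cauchy-Schwarz and the Lipschitz
    bound, psi has nonpositive derivative. Only the segment matters, which is
    why a Lipschitz bound on the convex set C suffices. *)
Lemma descent_lemma (C : set 'rV[R]_n) (f : 'rV[R]_n -> R) (L : R) u w :
  convex_set C -> (forall y, differentiable f y) ->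
  (forall y z, C y -> C z ->
     enorm (grad f y - grad f z) <= L * enorm (y - z)) ->
  C u -> C w ->
  f w <= f u + dot (grad f u) (w - u) + L / 2 * enorm (w - u) ^+ 2.
Proof.
move=> cC df lip Cu Cw; set d := w - u; set g := grad f u.
pose D := enorm d ^+ 2.
pose psi (t : R) := f (u + t *: d) - (t * dot g d + t ^+ 2 * (L / 2 * D)).
pose dpsi (t : R) := dot (grad f (u + t *: d)) d - (dot g d + t * (L * D)).
have psiD (t : R) : is_derive t 1 psi (dpsi t).
  have := is_derive_along (df (u + t *: d)) => h.
  have h2 : is_derive t 1 (fun s : R => s * dot g d + s ^+ 2 * (L / 2 * D))
     (dot g d + t * (L * D)).
    apply: is_derive_eq; rewrite /GRing.scale /=; lra.
  exact: is_deriveB.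
have psiC : {within `[0, 1], continuous psi}.
  apply: derivable_within_continuous => t _; exact: ex_derive.
have [c c01 E] := MVT ltr01 (fun t _ => psiD t) psiC.
have /andP[c0 c1] : 0 < c < 1 by rewrite in_itv in c01.
have dc : dpsi c <= 0.
  rewrite /dpsi opprD addrA -dotNl -dotDl subr_le0.
  apply: le_trans (Cauchy_Schwarz _ _) _.
  have -> : c * (L * D) = L * enorm (c *: d) * enorm d.
    by rewrite enormZ ?ltW// /D; ring.
  apply: ler_wpM2r; first exact: enorm_ge0.
  have := lip (u + c *: d) u; rewrite [u + _]addrC addrK; apply => //.
  by rewrite addrC; apply: convex_segment => //; rewrite !ltW.
move: E; rewrite subr0 mulr1 => E; move: dc; rewrite -E /psi.
rewrite scale1r scale0r addr0 (_ : u + d = w) -/D; first lra.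
by rewrite addrC subrK.
Qed.

(** With D = |d|^2, G = |g|^2 and B = <g, d> for d = w - u, the projection
    inequality at y = u reads
    alpha B + D <= g1 alpha^2 G + g2 (D + 2 alpha B + alpha^2 G) + g3 D.
    Solving for B requires dividing by alpha (1 - 2 g2), hence gbar2 < 1/2; it
    remains to replace g2 and g3 by the uniform bounds gbar2 and gbar. *)
Lemma inexact_proj_step (C : set 'rV[R]_n)
    (phi : R -> R -> R -> 'rV[R]_n -> 'rV[R]_n -> 'rV[R]_n -> R)
    (g1 g2 g3 gbar2 gbar alpha A : R) (u g w : 'rV[R]_n) :
  error_tolerance phi -> 0 <= g1 -> 0 <= g2 -> 0 <= g3 ->
  g2 < gbar2 -> g3 < gbar -> gbar2 < 2^-1 -> gbar < 2^-1 -> 0 < alpha ->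
  (g1 + g2) * enorm g ^+ 2 <= A ->
  C u -> inexact_proj C (phi g1 g2 g3) u (u - alpha *: g) w ->
  dot g (w - u) <= alpha / (1 - 2 * gbar2) * A
                   - (1 - gbar2 - gbar) / alpha * enorm (w - u) ^+ 2.
Proof.
move=> tol g10 g20 g30 g2b g3b gb2 gb al0 hA Cu [_ /(_ u Cu) hw].
have [_ hphi] := tol g1 g2 g3 g10 g20 g30 u (u - alpha *: g) w.
have := le_trans hw hphi.
set d := w - u.
have -> : u - alpha *: g - u = - (alpha *: g) by rewrite addrAC subrr add0r.
have -> : u - alpha *: g - w = - (alpha *: g + d).
  by rewrite /d opprD opprB addrAC [RHS]addrC.
have -> : w - (u - alpha *: g) = alpha *: g + d.
  by rewrite /d opprB addrCA addrC.
have -> : u - w = - d by rewrite opprB.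
clearbody d; rewrite !enorm_sqr !dotE (dotC d g).
have D0 := dot_ge0 d; have G0 := dot_ge0 g.
move: hA; rewrite enorm_sqr.
move: (dot d d) (dot g g) (dot g d) D0 G0 => D G B D0 G0 hA h.
have q0 : 0 < 1 - 2 * gbar2 by lra.
have r0 : 0 < 1 - 2 * g2 by lra.
have A0 : 0 <= A by apply: le_trans hA; rewrite mulr_ge0 // addr_ge0.
(* Collect B on the left; the slack in g2 < gbar2 and g3 < gbar multiplies D. *)
have key : alpha * (1 - 2 * g2) * B <= alpha ^+ 2 * A - (1 - gbar2 - gbar) * D.
  have : alpha ^+ 2 * ((g1 + g2) * G) <= alpha ^+ 2 * A.
    by rewrite ler_wpM2l // sqr_ge0.
  have : 0 <= (gbar2 - g2 + (gbar - g3)) * D by rewrite mulr_ge0 //; lra.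
  lra.
have step : B <= alpha / (1 - 2 * g2) * A
                 - (1 - gbar2 - gbar) / (alpha * (1 - 2 * g2)) * D.
  rewrite [leRHS](_ : _ = (alpha ^+ 2 * A - (1 - gbar2 - gbar) * D)
                          / (alpha * (1 - 2 * g2))); last first.
    by field; rewrite !gt_eqF.
  by rewrite ler_pdivlMr ?mulr_gt0// mulrC.
(* The factor 1 - 2 g2 may be lowered to 1 - 2 gbar2 in the coefficient of A,
   and raised to 1 in that of D, whose numerator is nonnegative. *)
apply: le_trans step _; apply: lerB.
  by rewrite ler_wpM2r // ler_pM2l // lef_pV2 // lerD2l lerN2; lra.
rewrite ler_wpM2r // ler_wpM2l; [lra|lra|].
by rewrite lef_pV2 ?posrE ?mulr_gt0 // ger_pMr //; lra.
Qed.

End Euclidean.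

Section Sequences.
Set Implicit Arguments.
Unset Strict Implicit.
Context {R : realType}.

Lemma forcing_sum_le (bm1 : R) (b a : nat -> R) (N : nat) :
  forcing_sequences bm1 b a -> \sum_(k < N.+1) a k <= bm1.
Proof.
case=> _ b0 _ _ hab.
(* a_k <= b_{k-1} - b_k telescopes; the induction needs the term - b_N. *)
suff h : \sum_(k < N.+1) a k <= bm1 - b N by apply: le_trans h _; rewrite gerBl.
elim: N => [|N IH].
  by rewrite big_ord_recr big_ord0 /= add0r; case/andP: (hab 0%N).
rewrite big_ord_recr /=; have /andP[_ /=] := hab N.+1; lra.
Qed.

(** Each of the N + 1 squares is at least the square of the minimum. *)
Lemma bigmin_le_sqrt_mean (d : nat -> R) (s : R) (N : nat) :
  (forall k, 0 <= d k) -> \sum_(k < N.+1) d k ^+ 2 <= s ->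
  \big[Num.min/d 0%N]_(k < N.+1) d k <= Num.sqrt s / Num.sqrt N.+1%:R.
Proof.
move=> d0 ds; set m := \big[_/_]_(_ < _) _.
have m0 : 0 <= m by apply: le_bigmin => // *; exact: d0.
have ms : m ^+ 2 * N.+1%:R <= s.
  apply: le_trans ds.
  rewrite mulr_natr -[X in _ *+ X](card_ord N.+1) -sumr_const.
  apply: ler_sum => k _; rewrite ler_pXn2r ?nnegrE//.
  exact: bigmin_le.
have N0 : 0 < N.+1%:R :> R by [].
rewrite ler_pdivlMr ?sqrtr_gt0//.
rewrite -(ger0_norm m0) -sqrtr_sqr -sqrtrM ?sqr_ge0//.
exact: ler_wsqrtr.
Qed.

End Sequences.

Theorem theorem11 (R : realType) (n : nat)
    (C : set 'rV[R]_n) (f : 'rV[R]_n -> R) (L : R)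
    (phi : R -> R -> R -> 'rV[R]_n -> 'rV[R]_n -> 'rV[R]_n -> R)
    (bm1 : R) (b a : nat -> R) (gbar2 gbar alpha : R)
    (x : nat -> 'rV[R]_n)
    (C_neq0 : C !=set0) (C_closed : closed C) (C_convex : convex_set C)
    (f_C1 : continuously_differentiable f)
    (L_gt0 : 0 < L)
    (grad_lip : forall y z, C y -> C z ->
       enorm (grad f y - grad f z) <= L * enorm (y - z))
    (phi_tol : error_tolerance phi)
    (ba_forcing : forcing_sequences bm1 b a)
    (gbar2_lt : gbar2 < 2^-1) (gbar_lt : gbar < 2^-1)
    (alpha_gt0 : 0 < alpha) (alpha_lt : alpha < (1 - 2 * gbar) / L)
    (x_run : GInexPM_sequence C f phi a gbar2 gbar alpha x)
    (minimizers_neq0 : minimizers C f !=set0) :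
  let fstar := inf [set f y | y in C] in
  let nu := (1 - gbar2 - gbar) / alpha - L / 2 in
  let rho := alpha / (1 - 2 * gbar2) in
  let eta := f (x 0%N) - fstar + rho * bm1 in
  [/\ 0 < nu, 0 < rho &
    forall N : nat,
      \big[Num.min/enorm (x 1%N - x 0%N)]_(k < N.+1) enorm (x k.+1 - x k)
        <= Num.sqrt (eta / nu) / Num.sqrt N.+1%:R].
Proof.
move=> fstar nu rho eta.
have [df _] := f_C1.
have [x0 step] := x_run.
have Cx k : C (x k).
  by case: k => [//|k]; have [_ [? [? [? [_ _ _ _ []]]]]] := step k.
have q0 : 0 < 1 - 2 * gbar2 by lra.
have rho0 : 0 < rho by rewrite divr_gt0.
have nu0 : 0 < nu.
  rewrite subr_gt0 ltr_pdivlMr //; move: alpha_lt; rewrite ltr_pdivlMr //; lra.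
split=> // N.
have fx k : nu * enorm (x k.+1 - x k) ^+ 2 <= f (x k) - f (x k.+1) + rho * a k.
  have [g_neq0 [g1 [g2 [g3 [[g10 g20 g30] g12 g2b g3b xP]]]]] := step k.
  have G0 : 0 < enorm (grad f (x k)) ^+ 2.
    rewrite exprn_gt0 // lt_def enorm_ge0 andbT.
    by apply/eqP => /enorm_eq0.
  rewrite ler_pdivlMr // in g12.
  have := inexact_proj_step phi_tol g10 g20 g30 g2b g3b gbar2_lt gbar_lt
    alpha_gt0 g12 (Cx k) xP.
  have := descent_lemma C_convex df grad_lip (Cx k) (Cx k.+1).
  rewrite -/rho /nu; lra.
have fstar_le k : fstar <= f (x k).
  have [xs [_ xs_min]] := minimizers_neq0.
  apply: ge_inf; last by exists (x k).
  by exists (f xs) => _ [y Cy <-]; exact: xs_min.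
apply: (@bigmin_le_sqrt_mean _ (fun k => enorm (x k.+1 - x k))) => [k|].
  exact: enorm_ge0.
rewrite ler_pdivlMr // mulrC mulr_sumr.
apply: le_trans (ler_sum _ (fun (k : 'I_N.+1) _ => fx k)) _.
rewrite big_split /= -mulr_sumr lerD //; last first.
  by rewrite ler_wpM2l ?(ltW rho0) // (forcing_sum_le _ ba_forcing).
under eq_bigr do rewrite -opprB.
rewrite sumrN -(big_mkord xpredT (fun k => f (x k.+1) - f (x k))).
by rewrite telescope_sumr // opprB lerB.
Qed.
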